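(* Let $A$ be a finite set of prisoners with $|A|\ge2$, let $K$ be a set of colors with $|K|=2$, let $V$ be a visibility graph on $A$, and let $I$ be an inning function on $A$ with $IN\ge2$. Suppose the hat game $\mathcal{G}=(A,K,V,I)$ satisfies: (S4) every prisoner $a\in I_1$ sees all other hats: $V(a)=A\setminus\{a\}$; (S5) exactly two prisoners declare in the first inning: $|I_1|=2$; (S6) for every $n\in\{2,\dots,IN\}$ and every $a\in I_n$, $I_1\cup (I_{n-}\setminus\{a\})\subseteq V(a)$. Then there is a predictor $P$ for $\mathcal{G}$ such that for every coloring $f\in K^A$, at most one prisoner guesses incorrectly.
   Context: A hat game $(A,K,V,I)$ consists of: a set $A$ of prisoners and a set $K$ of colors (with $|A|,|K|\ge2$); a visibility graph $V\subseteq A^2$ with no loops, where $(a,b)\in V$ means $a$ sees $b$'s hat, and $V(a)=\{b:(a,b)\in V\}$; and an inning function $I$, a surjection from $A$ onto $\{\beta:1\le\beta\le\alpha\}$ for some nonzero ordinal $\alpha$. Write $IN=\max\operatorname{ran}(I)$, $I_\beta=\{a:I(a)=\beta\}$, $I_{n-}=\bigcup_{n\le\beta\le IN}I_\beta$, and $H(a)=\{b:I(b)<I(a)\}$. A coloring is $f\in K^A$. Strategies: for each $a$, a function $S_a:K^{H(a)}\times K^{V(a)}\to K$; the guess is defined by recursion on $I(a)$ as $\sigma_a(f)=S_a(h_a^f,f\restriction V(a))$ with $h_a^f=(\sigma_b(f))_{b\in H(a)}$. A predictor is $P:K^A\to K^A$ with $P(f)(a)=\sigma_a(f)$ for some family of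 strategies. Prisoner $a$ guesses incorrectly under $f$ if $P(f)(a)\ne f(a)$. *)

(* Defs.v *)
From mathcomp Require Import all_boot.
Set Implicit Arguments.
Unset Strict Implicit.
Unset Printing Implicit Defensive.

Definition sees (A : finType) (V : rel A) (a : A) : {set A} := [set b | V a b].

(* The range of [I] is exactly {1, ..., alpha}.  Innings are natural numbers:
   as [A] is finite, an ordinal alpha for which A surjects onto
   {beta : 1 <= beta <= alpha} is necessarily finite. *)
Definition inning_function (A : finType) (I : A -> nat) : Prop :=
  exists2 alpha : nat, 0 < alpha &
    forall beta : nat, (exists a : A, I a = beta) <-> 1 <= beta <= alpha.

Definition last_inning (A : finType) (I : A -> nat) : nat := \max_(a : A) I a.

Definition inning (A : finType) (I : A -> nat) (beta : nat) : {set A} :=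
  [set a | I a == beta].

Definition innings_from (A : finType) (I : A -> nat) (n : nat) : {set A} :=
  \bigcup_(n <= beta < (last_inning I).+1) inning I beta.

Definition hat_game (A K : finType) (V : rel A) (I : A -> nat) : Prop :=
  [/\ 2 <= #|A|, 2 <= #|K|, irreflexive V & inning_function I].

Definition coloring (A K : finType) : Type := {ffun A -> K}.

Definition heard (A : finType) (I : A -> nat) (a : A) : finType :=
  {b : A | I b < I a}.

Definition seen (A : finType) (V : rel A) (a : A) : finType := {b : A | V a b}.

Definition strategies (A K : finType) (V : rel A) (I : A -> nat) : Type :=
  forall a : A, {ffun heard I a -> K} * {ffun seen V a -> K} -> K.

Lemma earlier_wf (A : finType) (I : A -> nat) :
  well_founded (fun b a : A => I b < I a).
Proof.
move=> a; have [n] := ubnP (I a); elim: n a => [a|n IHn a lean].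
  by rewrite ltn0.
by constructor=> b ltba; apply: IHn; exact: leq_trans ltba lean.
Qed.

Definition guess (A K : finType) (V : rel A) (I : A -> nat)
    (S : strategies K V I) (f : coloring A K) : A -> K :=
  Fix (earlier_wf I) (fun _ : A => K)
    (fun a sigma => S a ([ffun b : heard I a => sigma (val b) (valP b)],
                         [ffun b : seen V a => f (val b)])).

Lemma guessE (A K : finType) (V : rel A) (I : A -> nat)
    (S : strategies K V I) (f : coloring A K) (a : A) :
  guess S f a = S a ([ffun b : heard I a => guess S f (val b)],
                     [ffun b : seen V a => f (val b)]).
Proof.
rewrite {1}/guess Fix_eq // => {}a g h eq_gh.
by congr (S a (_, _)); apply/ffunP=> b; rewrite !ffunE.
Qed.

Definition predictor (A K : finType) (V : rel A) (I : A -> nat)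
    (P : coloring A K -> coloring A K) : Prop :=
  exists S : strategies K V I, forall f a, P f a = guess S f a.

Definition incorrect (A K : finType) (P : coloring A K -> coloring A K)
    (f : coloring A K) : {set A} :=
  [set a | P f a != f a].

(* Main.v *)
(** Number the colors by bits, let p and q be the two first declarers and c the
    parity of all other hats.  Prisoner p guesses f q + c and q guesses
    f p + c + 1, so p is right iff f p + f q = c, and q is right iff
    f p + f q <> c: exactly one of them errs.  Everybody else sees f q and
    hears the guess of p, hence knows c; by induction on innings, the guesses
    heard from innings 2, 3, ... are correct, and together with the visible hats
    they leave one's own hat as the only unknown in c. *)
Require Import Defs.
From mathcomp Require Import all_boot.

Lemma bool_coding (K : finType) (cardK : #|K| = 2) : exists enc : K -> bool, exists2 dec : bool -> K,
  cancel enc dec & cancel dec enc.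
Proof.
have cardKb : #|K| = #|{: bool}| by rewrite cardK card_bool.
exists (fun k => enum_val (cast_ord cardKb (enum_rank k))).
exists (fun b => enum_val (cast_ord (esym cardKb) (enum_rank b))) => x.
  by rewrite enum_valK cast_ordK enum_rankK.
by rewrite enum_valK cast_ordKV enum_rankK.
Qed.

(** Hats and guesses reach a strategy as functions on subtypes. The default [false], neutral for
    [addb], lets parities be summed over [A] itself. *)
Definition bit_at (A K : finType) (enc : K -> bool) (Q : pred A)
    (g : {ffun {b : A | Q b} -> K}) (b : A) : bool :=
  if insub b is Some u then enc (g u) else false.

Lemma bit_atE (A K : finType) (enc : K -> bool) (Q : pred A) (F : A -> K) b :
  bit_at A K enc Q [ffun u => F (val u)] b = Q b && enc (F b).
Proof.
rewrite /bit_at; case: insubP => [u Qb ub|/negbTE-> //].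
by rewrite ffunE ub Qb.
Qed.

Lemma mem_innings_from (A : finType) (I : A -> nat) n b :
  n <= I b -> b \in innings_from I n.
Proof.
move=> le_n_Ib; rewrite /innings_from (bigD1_seq (I b)) ?iota_uniq //=.
  by rewrite !inE eqxx.
by rewrite mem_index_iota le_n_Ib ltnS /last_inning (leq_bigmax b).
Qed.

(** In the last branch [h p (+) v q] recovers the parity of all hats outside [p] and [q]; the two
    sums then remove every such hat but one's own. *)
Definition parity_strategy (A K : finType) (V : rel A) (I : A -> nat)
    (enc : K -> bool) (dec : bool -> K) (p q : A) : strategies K V I :=
  fun a hv =>
    let h := bit_at A K enc (fun b => I b < I a) hv.1 in
    let v := bit_at A K enc (V a) hv.2 in
    dec (if a == p then \big[addb/false]_b v b
         else if a == q then ~~ \big[addb/false]_b v b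
         else h p (+) v q
              (+) \big[addb/false]_(b | 1 < I b < I a) h b
              (+) \big[addb/false]_(b | I a <= I b) v b).

Theorem theorem4p2 (A K : finType) (V : rel A) (I : A -> nat)
    (G : hat_game K V I)
    (cardK : #|K| = 2)
    (IN_ge2 : 2 <= last_inning I)
    (S4 : forall a : A, a \in inning I 1 -> sees V a = [set: A] :\ a)
    (S5 : #|inning I 1| = 2)
    (S6 : forall n : nat, 2 <= n <= last_inning I ->
          forall a : A, a \in inning I n ->
          inning I 1 :|: (innings_from I n :\ a) \subset sees V a) :
  exists P : coloring A K -> coloring A K,
    predictor V I P /\
    forall f : coloring A K, #|incorrect P f| <= 1.
Proof.
case: G => _ _ irrV [alpha _ I_range].
have I_gt0 b : 0 < I b by have [/(_ (ex_intro _ b erefl))/andP[]] := I_range (I b).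
have /cards2P[p [q [neq_pq def1]]] : #|inning I 1| == 2 by rewrite S5.
have [enc [dec encK decK]] := bool_coding K cardK.
have in1 b : (I b == 1) = (b == p) || (b == q).
  by have := in_set2 b p q; rewrite -def1 inE.
have gt1 b : (1 < I b) = (b != p) && (b != q).
  by rewrite -negb_or -in1 ltn_neqAle I_gt0 andbT eq_sym.
have Ip : I p = 1 by apply/eqP; rewrite in1 eqxx.
have Iq : I q = 1 by apply/eqP; rewrite in1 eqxx orbT.
have V_first a b : I a = 1 -> V a b = (b != a).
  move=> Ia; have : b \in sees V a = (b \in [set: A] :\ a).
    by rewrite S4 // inE Ia.
  by rewrite !inE andbT.
have V_later a b : 1 < I a -> (I b == 1) || (I a <= I b) && (b != a) -> V a b.
  move=> Ia Hb.
  have nP : 2 <= I a <= last_inning I by rewrite Ia /last_inning (leq_bigmax a).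
  have a_in : a \in inning I (I a) by rewrite inE.
  have /subsetP/(_ b) := S6 _ nP a a_in.
  rewrite !inE; apply; case/orP: Hb => [-> // | /andP[/mem_innings_from-> ->]].
  by rewrite orbT.
pose S := parity_strategy A K V I enc dec p q.
exists (fun f => [ffun a => guess S f a]); split.
  by exists S => f a; rewrite ffunE.
move=> f; pose e b := enc (f b).
pose c := \big[addb/false]_(b | 1 < I b) e b.
have guess_p : enc (guess S f p) = e q (+) c.
  rewrite guessE /S /parity_strategy eqxx decK /=.
  under eq_bigr do rewrite bit_atE V_first //.
  (* The own hat of [p] contributes the default [false], [q] contributes [e q], and the remaining
     terms form [c]. *)
  rewrite (bigD1 p) //= eqxx /= (bigD1 q) /= eq_sym neq_pq //=.
  congr (_ (+) _); apply: eq_big => b; first by rewrite gt1.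
  by case/andP=> ->.
have guess_q : enc (guess S f q) = ~~ (e p (+) c).
  rewrite guessE /S /parity_strategy eq_sym (negbTE neq_pq) eqxx decK /=.
  under eq_bigr do rewrite bit_atE V_first //.
  rewrite (bigD1 q) //= eqxx /= (bigD1 p) //= neq_pq /=.
  congr (~~ (_ (+) _)); apply: eq_big => b; first by rewrite gt1 andbC.
  by case/andP=> ->.
have guess_later a : 1 < I a -> guess S f a = f a.
  have [n] := ubnP (I a); elim: n a => // n IHn a leIa Ia.
  apply: (can_inj encK).
  move: (Ia); rewrite gt1 => /andP[/negbTE ap /negbTE aq].
  rewrite guessE /S /parity_strategy ap aq decK /= !bit_atE.
  rewrite Ip Ia V_later ?Iq //= guess_p -/(e q) -/(e a).
  (* The bound [1 < I b] keeps out [p] and [q], to whom the induction hypothesis does not apply. *)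
  rewrite [X in _ (+) X (+) _](eq_bigr e); last first.
    move=> b /andP[Ib lt_ba]; rewrite bit_atE lt_ba IHn //.
    exact: leq_trans lt_ba leIa.
  (* The range includes [a], but its term is [false] since nobody sees their own hat. *)
  rewrite [X in _ (+) X](bigD1 a) //= bit_atE irrV addFb.
  rewrite [X in _ (+) X](eq_bigr e); last first.
    by move=> b Hb; rewrite bit_atE V_later // Hb orbT.
  (* Cut [c] into the hats declared before [a], the hat of [a], and the rest: the outer two cancel
     against the strategy's sums and [e q] against itself, leaving [e a]. *)
  rewrite /c (bigID (fun b => I b < I a)) /= [X in _ (+) (_ (+) X)](bigD1 a) /=; last first.
    by rewrite Ia ltnn.
  rewrite [X in _ (+) (_ (+) (_ (+) X))](eq_bigl (fun b => (I a <= I b) && (b != a))).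
    by do !case: (\big[_/_]_(_ | _) _); case: (e a); case: (e q).
  move=> b; rewrite -leqNgt; case: (leqP (I a)) => [le_ab|]; last by rewrite andbF.
  by rewrite (leq_trans Ia le_ab).
have [r sub_r] : exists r, incorrect (fun f => [ffun a => guess S f a]) f \subset [set r].
  have good b : guess S f b = f b <-> enc (guess S f b) = e b.
    by split=> [-> // | /(can_inj encK)].
  (* The test says that [p] is right. It amounts to [e q = e p (+) c], the negation of what [q]
     guesses, so [q] is right exactly when it fails. *)
  exists (if e p == e q (+) c then q else p).
  apply/subsetP=> b; rewrite !inE ffunE; apply: contraR => neq_b.
  apply/eqP; have [/guess_later // | ] := boolP (1 < I b).
  rewrite gt1 negb_and !negbK => /orP[] /eqP eq_b; apply/good;
    move: neq_b; rewrite eq_b ?guess_p ?guess_q;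
    by case: (e p); case: (e q); case: (c); rewrite ?eqxx.
by rewrite -(cards1 r) subset_leq_card.
Qed.
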